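(* Let $N,M\ge1$ be integers and $\tau\ge0$ an even integer with $N>2\tau+M$, and let $I_1,\ldots,I_M$ be a partition of $\{0,\ldots,N-1\}$ into $M$ nonempty segments of consecutive integers. Let ${\bf F}\in\mathbb{R}^N$ be such that: (i) $\mathcal{DFT}\{{\bf F}\}(k)=0$ for all $k\in\{0,\ldots,N-1\}\setminus CS$; (ii) the sign of ${\bf F}$ is constant on each of the segments $I_1,\ldots,I_M$; and (iii) $|F_j|\ne0$ whenever $j$ is the first or the last index of one of the segments. Let ${\bf s}=\mathrm{sign}({\bf F})\in\{-1,1\}^N$. Then the only solutions ${\bf X}=(X_0,\ldots,X_{N-1})\in\mathbb{C}^N$ of the system of linear equations $$\mathcal{DFT}\{|{\bf F}|{\bf X}\}(k)=0\quad\text{for all } k\in\{0,\ldots,N-1\}\setminus CS,$$ $$X_j=X_{j+1}\quad\text{for all } j\in\mathcal{S},$$ are of the form ${\bf X}=c\,{\bf s}$ with $c\in\mathbb{C}$.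
   Context: Vectors are indexed as ${\bf F}=(F_0,\ldots,F_{N-1})$. With $\omega_j=2\pi j/N$ and $\mathrm{i}=\sqrt{-1}$, the discrete Fourier transform is $$\mathcal{DFT}\{{\bf F}\}(k)=\frac1N\sum_{j=0}^{N-1}F_j e^{\mathrm{i}\omega_j k},\qquad k=0,\ldots,N-1.$$ The compact support set of length $\tau+1$ is $$CS=\{k\in\{0,\ldots,N-1\}: k\equiv \ell \ (\mathrm{mod}\ N)\ \text{for some integer } \ell \text{ with } -\tau/2\le \ell\le \tau/2\}.$$ $|{\bf F}|{\bf X}$ denotes the entrywise product, with entries $|F_j|X_j$. The sign of ${\bf F}$ is constant on $I_m$ if there is $a_m\in\{-1,1\}$ with $F_j=a_m|F_j|$ for all $j\in I_m$; the vector ${\bf s}=\mathrm{sign}({\bf F})$ is given by $s_j=a_m$ for $j\in I_m$ (this is the usual sign wherever $F_j\ne0$, and assigns the common sign of the segment to interior zero entries). The segmentation need not be minimal: adjacent segments may carry the same sign. $\mathcal{S}$ denotes the set of all indices $j\in\{0,\ldots,N-1\}$ that are not the last index of the segment containing them (so $\mathcal{S}$ has $N-M$ elements). *)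

(* Defs.v *)
(* MathComp-Analysis: the real numbers are any [R : realType]
   and the complex numbers are [R[i]]. *)
From mathcomp Require Export all_boot all_order all_algebra.
From mathcomp Require Export reals trigo.
From mathcomp Require Export complex.

Set Implicit Arguments.
Unset Strict Implicit.
Unset Printing Implicit Defensive.

Import Order.TTheory GRing.Theory Num.Theory.
Local Open Scope ring_scope.
Local Open Scope complex_scope.

(* The libraries have no complex exponential: e^(i t) is given by Euler's
   formula. *)
Definition expi (R : realType) (t : R) : R[i] := cos t +i* sin t.

Definition omega (R : realType) (N j : nat) : R := 2 * pi * j%:R / N%:R.

(* The sign in the exponent is + and the factor 1/N is on the direct
   transform. *)
Definition dft (R : realType) (N : nat) (F : 'rV[R[i]]_N) (k : 'I_N) : R[i] :=
  N%:R^-1 * \sum_(j < N) F 0 j * expi (omega R N j * k%:R).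

(* Only used with [tau] even, so that [tau./2] is exactly tau / 2; the set then
   has tau + 1 elements whenever tau < N. *)
Definition compact_support (N tau : nat) (k : 'I_N) : Prop :=
  exists2 l : int, - (tau./2)%:Z <= l <= (tau./2)%:Z & (k%:Z = l %[mod N])%Z.

Definition embed (R : realType) (N : nat) (F : 'rV[R]_N) : 'rV[R[i]]_N :=
  map_mx (real_complex R) F.

Definition abs_mul (R : realType) (N : nat) (F : 'rV[R]_N) (X : 'rV[R[i]]_N) :
    'rV[R[i]]_N :=
  \row_j (`|F 0 j|%:C * X 0 j).

(* A nonempty set of consecutive indices. *)
Definition is_segment (N : nat) (A : {set 'I_N}) : Prop :=
  exists p q : 'I_N, (p <= q)%N /\ A = [set j : 'I_N | (p <= j <= q)%N].

(* The segments need not be listed from left to right. *)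
Definition is_segmentation (N M : nat) (I : 'I_M -> {set 'I_N}) : Prop :=
  [/\ forall m, is_segment (I m),
      forall m n, m != n -> [disjoint I m & I n]
    & \bigcup_(m < M) I m = [set: 'I_N]].

Definition is_first (N : nat) (A : {set 'I_N}) (j : 'I_N) : bool :=
  (j \in A) && [forall i in A, (j <= i)%N].

Definition is_last (N : nat) (A : {set 'I_N}) (j : 'I_N) : bool :=
  (j \in A) && [forall i in A, (i <= j)%N].

Definition non_last (N M : nat) (I : 'I_M -> {set 'I_N}) : {set 'I_N} :=
  [set j | [exists m, (j \in I m) && ~~ is_last (I m) j]].

Definition is_sign_on (R : realType) (N : nat) (F : 'rV[R]_N)
    (A : {set 'I_N}) (a : R) : Prop :=
  (a = -1 \/ a = 1) /\ forall j, j \in A -> F 0 j = a * `|F 0 j|.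

Definition sign_constant_on (R : realType) (N : nat) (F : 'rV[R]_N)
    (A : {set 'I_N}) : Prop :=
  exists a : R, is_sign_on F A a.

(* The common sign [a] of a segment is also given to its zero entries.  It is
   unique as soon as [F] does not vanish identically on the segment, so for such
   [F] at most one [s] satisfies this. *)
Definition is_sign_vector (R : realType) (N M : nat) (I : 'I_M -> {set 'I_N})
    (F s : 'rV[R]_N) : Prop :=
  forall m, exists2 a : R, is_sign_on F (I m) a & forall j, j \in I m -> s 0 j = a.

(* For [j] in [non_last I] one has j + 1 < N, so [ordS j], the successor
   modulo N, is the index j + 1. *)
Definition is_solution (R : realType) (N M tau : nat) (I : 'I_M -> {set 'I_N})
    (F : 'rV[R]_N) (X : 'rV[R[i]]_N) : Prop :=
  (forall k : 'I_N, ~ compact_support tau k -> dft (abs_mul F X) k = 0) /\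
  (forall j, j \in non_last I -> X 0 j = X 0 (ordS j)).

(* Main.v *)
Require Import Defs.
From mathcomp Require Import zify ring lra.
Import Order.TTheory GRing.Theory Num.Theory.
Local Open Scope ring_scope.
Local Open Scope complex_scope.

Set Implicit Arguments.
Unset Strict Implicit.
Unset Printing Implicit Defensive.

(** Write [z = e^(2 i pi / N)].  A vector whose Fourier transform lives on the
    compact support set is, up to the unimodular factors [z ^ (j tau / 2)], the
    list of values at the [N]-th roots of unity [z ^ j] of a polynomial of
    degree at most [tau] ([bandlimited_poly]).

    Let [G = |F| X], and write [G = F Y] with [Y_j = s_j X_j], which is
    constant on every segment.  If [p] and [q] are the polynomials of [F] and
    [G], the discrete Wronskian [p(x) q(z x) - q(x) p(z x)] has degree at most
    [2 tau] and its value at [z ^ j] is, up to a unimodular factor,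
    [F_j G_(j+1) - G_j F_(j+1) = F_j F_(j+1) (Y_(j+1) - Y_j)].  It vanishes for
    the at least [N - M > 2 tau] indices [j] that are not last in their
    segment, so it vanishes identically ([bandlimited_wronskian]).  Reading its
    value at the last index of a segment, where neither [F_j] nor [F_(j+1)]
    is zero, shows that [Y] does not jump between segments.  Hence [Y] is a
    constant [c], and [X = c s] because [s_j ^ 2 = 1].

    Conversely [|F| (c s) = c F] has the same support in frequency as [F], and
    [s] is constant on the segments. *)

(** * The complex exponential and roots of unity *)

Lemma expi0 (R : realType) : expi (0 : R) = 1.
Proof. by rewrite /expi cos0 sin0. Qed.

Lemma expiD (R : realType) (x y : R) : expi (x + y) = expi x * expi y.
Proof.
rewrite /expi cosD sinD; apply/eqP.
by rewrite eq_complex /= eqxx /= addrC [X in X == _]addrC [X in _ == X]addrC.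
Qed.

Lemma expiM_natr (R : realType) (x : R) (n : nat) :
  expi (x * n%:R) = expi x ^+ n.
Proof.
elim: n => [|n IHn]; first by rewrite mulr0 expi0 expr0.
by rewrite mulrSr mulrDr mulr1 expiD IHn exprSr.
Qed.

(** By the duplication formula [cos (2 y) = 1 - 2 (sin y)^2], and [sin] is
    positive on the open half period. *)
Lemma expi_neq1 (R : realType) (x : R) : 0 < x < 2 * pi -> expi x != 1.
Proof.
move=> /andP[x_gt0 x_lt]; rewrite eq_complex negb_and /=; apply/orP; left.
have sin_gt0 : 0 < sin (x / 2) by apply: sin_gt0_pi; apply/andP; split; lra.
have -> : x = (x / 2) *+ 2 by rewrite mulr2n; lra.
rewrite cos_mulr2n cos2sin2.
by apply/eqP => cos1; nra.
Qed.

Definition unity_gen (R : realType) (N : nat) : R[i] := expi (2 * pi / N%:R).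

Lemma unity_gen_primitive (R : realType) (N : nat) :
  (0 < N)%N -> N.-primitive_root (unity_gen R N).
Proof.
move=> N_gt0; rewrite /primitive_root_of_unity N_gt0 /=.
have N0 : 0 < N%:R :> R by rewrite ltr0n.
apply/forallP => i; rewrite unity_rootE -expiM_natr; apply/eqP.
case: (eqVneq i.+1 N) => [iN|neq_iN].
  rewrite iN divfK ?lt0r_neq0// mulrC mulr_natr.
  by rewrite /expi cos2pi sin2pi; apply/eqP.
apply/negbTE/expi_neq1; have pi0 := @pi_gt0 R.
have iN : (i.+1 < N)%N by rewrite ltn_neqAle neq_iN ltn_ord.
apply/andP; split; first by rewrite mulr_gt0 ?divr_gt0 ?mulr_gt0 ?ltr0n.
by rewrite -mulrA gtr_pMr ?mulr_gt0// mulrC ltr_pdivrMr// mul1r ltr_nat.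
Qed.

Lemma sum_primitive_root_expr (R : idomainType) (n : nat) (z : R) (m : nat) :
  n.-primitive_root z ->
  \sum_(k < n) z ^+ (m * k) = if (n %| m)%N then n%:R else 0.
Proof.
move=> z_prim; rewrite (prim_order_dvd z_prim).
under eq_bigr do rewrite exprM.
have [->|zm_neq1] := eqVneq.
  by under eq_bigr do rewrite expr1n; rewrite sumr_const card_ord.
apply: (mulfI (x := z ^+ m - 1)); first by rewrite subr_eq0.
by rewrite -subrX1 exprAC (prim_expr_order z_prim) expr1n subrr mulr0.
Qed.

(** * Band-limited vectors as polynomials *)

Lemma dftE (R : realType) (N : nat) (F : 'rV[R[i]]_N) (k : 'I_N) :
  dft F k = N%:R^-1 * \sum_(j < N) F 0 j * unity_gen R N ^+ (j * k).
Proof.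
congr (_ * _); apply: eq_bigr => j _; congr (_ * _).
by rewrite -expiM_natr /omega; congr expi; rewrite natrM; ring.
Qed.

(** Orthogonality of the characters of the cyclic group.  The exponent [- j k]
    of the inverse transform is replaced by [j (N - k)], congruent to it modulo
    [N], so that only natural powers occur. *)
Lemma dft_inversion (R : realType) (N : nat) (F : 'rV[R[i]]_N) (j : 'I_N) :
  F 0 j = \sum_(k < N) dft F k * unity_gen R N ^+ (j * (N - k)).
Proof.
have N_gt0 : (0 < N)%N by apply: leq_ltn_trans (ltn_ord j).
have z_prim := unity_gen_primitive R N_gt0; set z := unity_gen R N in z_prim *.
transitivity (N%:R^-1 *
    \sum_(i < N) F 0 i * \sum_(k < N) z ^+ ((i + (N - j)) * k)).
  have sum_z (i : 'I_N) :
      \sum_(k < N) z ^+ ((i + (N - j)) * k) = if i == j then N%:R else 0.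
    (* [0 < i + N - j < 2 N], so [N] is the only multiple of [N] it can be. *)
    rewrite sum_primitive_root_expr//; congr (if _ then _ else _).
    have iN := ltn_ord i; have jN := ltn_ord j; rewrite -val_eqE /=.
    apply/idP/eqP => [/dvdnP[m]|->]; last by rewrite subnKC ?dvdnn// ltnW.
    by case: m => [|[|m]]; rewrite ?mulSn; lia.
  rewrite (bigD1 j)//= sum_z eqxx big1 => [|i /negbTE neq_ij]; last first.
    by rewrite sum_z neq_ij mulr0.
  by rewrite addr0 mulrCA mulVf ?mulr1// (prim_root_natf_neq0 z_prim).
under [RHS]eq_bigr do rewrite dftE -mulrA.
rewrite -mulr_sumr; congr (_ * _).
under [RHS]eq_bigr do rewrite mulr_suml.
rewrite exchange_big /=; apply: eq_bigr => i _; rewrite mulr_sumr.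
apply: eq_bigr => k _; rewrite -mulrA; congr (_ * _); rewrite -exprD.
(* [(N - j) k] and [j (N - k)] are both [- j k] modulo [N]. *)
apply/eqP; rewrite (eq_prim_root_expr z_prim) mulnDl.
rewrite eqn_modDl -(modnMDl j ((N - j) * k)) -(modnMDl k (j * (N - k))).
apply/eqP; congr (_ %% _)%N.
have := ltn_ord k; have := ltn_ord j; nia.
Qed.

Definition bandlimited (R : realType) (N tau : nat) (F : 'rV[R[i]]_N) : Prop :=
  forall k : 'I_N, ~ compact_support tau k -> dft F k = 0.

(** The frequency [k = l mod N] contributes the monomial of exponent
    [tau/2 - l], which lies between [0] and [tau]. *)
Lemma bandlimited_poly (R : realType) (N tau : nat) (F : 'rV[R[i]]_N) :
  ~~ odd tau -> (tau < N)%N -> bandlimited tau F ->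
  exists2 p : {poly R[i]}, (size p <= tau.+1)%N &
    forall j : 'I_N,
      p.[unity_gen R N ^+ j] = unity_gen R N ^+ (j * tau./2) * F 0 j.
Proof.
move=> tau_even tau_lt bandF; set z := unity_gen R N.
have z_prim : N.-primitive_root z by apply: unity_gen_primitive; lia.
exists (\sum_(k < N) dft F k *: 'X^((tau./2 + (N - k)) %% N)) => [|j].
  apply: leq_trans (size_sum _ _ _) _; apply/bigmax_leqP => k _.
  have [->|dftk] := eqVneq (dft F k) 0; first by rewrite scale0r size_poly0.
  rewrite (leq_trans (size_scale_leq _ _))// size_polyXn ltnS leqNgt.
  apply/negP => tau_lt_k; move/eqP: dftk; apply; apply: bandF.
  move=> [l l_bound k_l]; move: tau_lt_k; apply/negP; rewrite -leqNgt.
  suff -> : ((tau./2 + (N - k)) %% N)%N = `|(tau./2)%:Z - l|%N by lia.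
  apply/eqP; rewrite -eqz_nat -modz_nat; apply/eqP.
  have -> : ((tau./2 + (N - k))%N : int) = (tau./2)%:Z - k%:Z + N%:Z.
    by have := ltn_ord k; lia.
  rewrite modzDr -modzDmr -modzNm k_l modzNm modzDmr modz_small; lia.
rewrite horner_sum [F 0 j]dft_inversion mulr_sumr; apply: eq_bigr => k _.
rewrite hornerZ hornerXn mulrCA; congr (_ * _).
by rewrite -!exprM -exprD -mulnDr !(mulnC j) !exprM (prim_expr_mod z_prim).
Qed.

(** The discrete Wronskian of the two polynomials has degree at most [2 tau],
    hence vanishes at all [N] roots of unity as soon as it vanishes at more than
    [2 tau] of them.  Multiplication by [z] permutes these roots cyclically,
    which is why the index shift is the cyclic successor. *)
Lemma bandlimited_wronskian (R : realType) (N tau : nat) (F G : 'rV[R[i]]_N)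
    (S : {set 'I_N}) :
  ~~ odd tau -> bandlimited tau F -> bandlimited tau G -> (2 * tau < #|S|)%N ->
  (forall j, j \in S -> F 0 j * G 0 (ordS j) = G 0 j * F 0 (ordS j)) ->
  forall j, F 0 j * G 0 (ordS j) = G 0 j * F 0 (ordS j).
Proof.
move=> tau_even bandF bandG S_large wronskS.
have tau_lt : (tau < N)%N.
  have := leq_trans S_large (max_card (mem S)); rewrite card_ord; lia.
have [p size_p pE] := bandlimited_poly tau_even tau_lt bandF.
have [q size_q qE] := bandlimited_poly tau_even tau_lt bandG.
set z := unity_gen R N in pE qE.
have z_prim : N.-primitive_root z by apply: unity_gen_primitive; lia.
have z_neq0 : z != 0 by rewrite (prim_root_eq0 z_prim); lia.
pose W := p * (q \Po (z *: 'X)) - q * (p \Po (z *: 'X)).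
have WE (j : 'I_N) : W.[z ^+ j] = z ^+ ((j + ordS j) * tau./2) *
    (F 0 j * G 0 (ordS j) - G 0 j * F 0 (ordS j)).
  have zS : z * z ^+ j = z ^+ ordS j by rewrite -exprS (prim_expr_mod z_prim).
  rewrite /W !hornerE !horner_comp !hornerE zS !pE !qE mulnDl exprD; ring.
have size_W : (size W <= (2 * tau).+1)%N.
  have size_shift (r : {poly R[i]}) : size (r \Po (z *: 'X)) = size r.
    by rewrite size_comp_poly2// size_scale// size_polyX.
  have size_pq : (size p + size q <= (2 * tau).+2)%N.
    by apply: leq_trans (leq_add size_p size_q) _; lia.
  rewrite (leq_trans (size_polyD _ _))// size_polyN geq_max.
  apply/andP; split; rewrite (leq_trans (size_polyMleq _ _))// size_shift.
    by rewrite -subn1 leq_subLR.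
  by rewrite -subn1 leq_subLR addnC.
have W0 : W = 0.
  apply/eqP; apply: contraT => W_neq0.
  pose rs := [seq z ^+ (j : 'I_N) | j <- enum S].
  have roots_rs : all (root W) rs.
    apply/allP => _ /mapP[j jS ->]; rewrite mem_enum in jS.
    by rewrite /root WE wronskS// subrr mulr0.
  have uniq_rs : uniq rs.
    rewrite map_inj_uniq ?enum_uniq// => i j /eqP.
    by rewrite (eq_prim_root_expr z_prim) !modn_small// => /eqP/val_inj.
  have := max_poly_roots W_neq0 roots_rs uniq_rs.
  by rewrite size_map -cardE => /leq_trans/(_ size_W); rewrite ltnS leqNgt S_large.
move=> j; apply/eqP; rewrite -subr_eq0; have := WE j; rewrite W0 horner0.
by move=> /esym/eqP; rewrite mulf_eq0 expf_eq0 (negbTE z_neq0) andbF.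
Qed.

(** * Segmentations *)

Lemma segmentation_cover (N M : nat) (I : 'I_M -> {set 'I_N}) (j : 'I_N) :
  is_segmentation I -> exists m, j \in I m.
Proof.
case=> _ _ coverI; have : j \in [set: 'I_N] by rewrite inE.
by rewrite -coverI => /bigcupP[m _ jm]; exists m.
Qed.

Lemma non_lastPn (N M : nat) (I : 'I_M -> {set 'I_N}) (j : 'I_N) (m : 'I_M) :
  j \notin non_last I -> j \in I m -> is_last (I m) j.
Proof.
rewrite inE negb_exists => /forallP/(_ m).
by rewrite negb_and negbK => /orP[/negbTE->|].
Qed.

(** A segment has at most one last index, so at most [M] indices are last. *)
Lemma card_non_last (N M : nat) (I : 'I_M -> {set 'I_N}) :
  is_segmentation I -> (N <= M + #|non_last I|)%N.
Proof.
move=> segI; rewrite -[X in (X <= _)%N](card_ord N) -(cardsC (non_last I)).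
rewrite addnC leq_add2r -(card_imset _ Some_inj).
pose last_of m := [pick j | is_last (I m) j].
rewrite -[X in (_ <= X)%N](card_ord M) -cardsT.
apply: leq_trans (leq_imset_card last_of _); apply: subset_leq_card.
apply/subsetP => _ /imsetP[j + ->]; rewrite inE => j_last.
have [m jm] := segmentation_cover j segI.
apply/imsetP; exists m; first by rewrite inE.
have /andP[_ /forall_inP j_max] := non_lastPn j_last jm.
rewrite /last_of; case: pickP => [i /andP[im /forall_inP i_max]|/(_ j)].
  by congr Some; apply/val_inj/anti_leq; rewrite i_max ?j_max.
by rewrite (non_lastPn j_last jm).
Qed.

Lemma non_last_succ (N M : nat) (I : 'I_M -> {set 'I_N}) (j : 'I_N) :
  is_segmentation I -> j \in non_last I ->
  exists2 m, j \in I m & ordS j \in I m.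
Proof.
case=> segI _ _; rewrite inE => /existsP[m /andP[jm]].
rewrite /is_last jm /= negb_forall_in => /exists_inP[i im]; rewrite -ltnNge => ji.
exists m => //; move: jm im; have [p [q [_ ->]]] := segI m.
have jN : (j.+1 < N)%N by apply: leq_ltn_trans ji _.
by rewrite !inE /= modn_small//; lia.
Qed.

(** The segment of [j + 1] is an interval without [j], so [j + 1] is its left
    end. *)
Lemma last_succ_first (N M : nat) (I : 'I_M -> {set 'I_N}) (j : 'I_N) :
  is_segmentation I -> j \notin non_last I -> (j.+1 < N)%N ->
  exists m n, is_last (I m) j /\ is_first (I n) (ordS j).
Proof.
move=> segI j_last jN; have [m jm] := segmentation_cover j segI.
have [n jn] := segmentation_cover (ordS j) segI.
have lastm := non_lastPn j_last jm; exists m, n; split=> //.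
have valS : ordS j = j.+1 :> nat by rewrite /= modn_small.
have neq_mn : m != n.
  apply: contraTneq lastm => ->; rewrite /is_last negb_and negb_forall_in.
  by apply/orP; right; apply/exists_inP; exists (ordS j); rewrite // valS ltnn.
have [seg disj _] := segI; have := disjointFr (disj _ _ neq_mn) jm.
rewrite /is_first jn /=; move: jn; have [p [q [_ ->]]] := seg n.
rewrite !inE valS => jpq j_npq; apply/forall_inP => i; rewrite inE modn_small//; lia.
Qed.

(** * Uniqueness of the sign *)

Theorem theorem3 (R : realType) (N M tau : nat)
    (N_ge1 : (1 <= N)%N) (M_ge1 : (1 <= M)%N) (tau_even : ~~ odd tau)
    (N_large : (2 * tau + M < N)%N)
    (I : 'I_M -> {set 'I_N}) (I_segm : is_segmentation I)
    (F : 'rV[R]_N)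
    (F_supp : forall k : 'I_N, ~ compact_support tau k -> dft (embed F) k = 0)
    (F_sign : forall m : 'I_M, sign_constant_on F (I m))
    (F_ends : forall (m : 'I_M) (j : 'I_N),
       is_first (I m) j || is_last (I m) j -> `|F 0 j| <> 0)
    (s : 'rV[R]_N) (s_sign : is_sign_vector I F s)
    (X : 'rV[R[i]]_N) :
  is_solution tau I F X <-> exists c : R[i], X = c *: embed s.

Proof.
have band_F : bandlimited tau (embed F) := F_supp.
have s_sqr j : s 0 j * s 0 j = 1.
  have [m jm] := segmentation_cover j I_segm.
  by have [a [a1 _] ->//] := s_sign m; case: a1 => ->; lra.
have absF j : `|F 0 j| = s 0 j * F 0 j.
  have [m jm] := segmentation_cover j I_segm.
  have [a [_ Fa] sa] := s_sign m.
  by rewrite [in RHS](Fa _ jm) -(sa _ jm) mulrA s_sqr mul1r.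
have s_succ j : j \in non_last I -> s 0 j = s 0 (ordS j).
  move=> /(non_last_succ I_segm)[m jm jSm].
  by have [a _ sa] := s_sign m; rewrite !sa.
split=> [[band_G X_succ]|[c ->]]; last first.
  split=> [k /F_supp dft0|j /s_succ sj]; last by rewrite !mxE sj.
  suff -> : abs_mul F (c *: embed s) = c *: embed F.
    move: dft0; rewrite !dftE => /eqP; rewrite mulf_eq0 => /orP[/eqP->|/eqP sum0].
      by rewrite mul0r.
    under eq_bigr do rewrite mxE -mulrA.
    by rewrite -mulr_sumr sum0 !mulr0.
  apply/rowP => j; rewrite !mxE absF mulrCA -rmorphM /=.
  by rewrite mulrAC s_sqr mul1r.
(* As [X = s Y] and [|F| = s F], the vector [|F| X] is [F Y]. *)
pose Y j := (s 0 j)%:C * X 0 j.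
have XY j : X 0 j = (s 0 j)%:C * Y j.
  by rewrite /Y mulrA -rmorphM s_sqr rmorph1 mul1r.
have GE j : abs_mul F X 0 j = embed F 0 j * Y j.
  by rewrite !mxE absF rmorphM /= /Y mulrA (mulrC (s 0 j)%:C).
have wronskE j : (embed F 0 j * abs_mul F X 0 (ordS j) =
    abs_mul F X 0 j * embed F 0 (ordS j)) <->
    embed F 0 j * embed F 0 (ordS j) * Y (ordS j) =
    embed F 0 j * embed F 0 (ordS j) * Y j.
  by rewrite !GE mulrA [in X in _ = X <-> _]mulrAC.
have Y_non_last j : j \in non_last I -> Y j = Y (ordS j).
  by move=> jS; rewrite /Y s_succ// X_succ.
have wronsk : forall j, embed F 0 j * abs_mul F X 0 (ordS j) =
    abs_mul F X 0 j * embed F 0 (ordS j).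
  apply: (bandlimited_wronskian tau_even band_F band_G (S := non_last I)).
    have := card_non_last I_segm; lia.
  by move=> j /Y_non_last Yj; apply/wronskE; rewrite Yj.
have Y_succ (j : 'I_N) : (j.+1 < N)%N -> Y j = Y (ordS j).
  move=> jN; case: (boolP (j \in non_last I)) => [/Y_non_last//|j_last].
  have [m [n [lastm firstn]]] := last_succ_first I_segm j_last jN.
  (* Across a boundary the Wronskian can be divided by [F_j F_(j+1)]. *)
  have Fj : F 0 j != 0.
    by rewrite -normr_eq0; apply/eqP/(F_ends m); rewrite lastm orbT.
  have FSj : F 0 (ordS j) != 0.
    by rewrite -normr_eq0; apply/eqP/(F_ends n); rewrite firstn.
  have /wronskE/mulfI -> // := wronsk j.
  by rewrite !mxE -rmorphM /= fmorph_eq0 mulf_neq0.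
pose j0 : 'I_N := Ordinal N_ge1.
have Y_const k (kN : (k < N)%N) : Y (Ordinal kN) = Y j0.
  elim: k kN => [|k IHk] kN; first by congr Y; apply: val_inj.
  rewrite -(IHk (ltnW kN)) [RHS]Y_succ//.
  by congr Y; apply: val_inj; rewrite /= modn_small.
by exists (Y j0); apply/rowP => -[k kN]; rewrite !mxE XY Y_const mulrC.
Qed.
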